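(* Let $k\ge 0$ be an integer and let $G$ be a triangulation with $m$ edges. (1) If $G$ has minimum degree at least $4$, then $\alpha_{k-reg}(L(G))\ge \frac{m}{68\chi_k(L(G))}$. (2) If $G$ has minimum degree at least $5$, then $\alpha_{k-reg}(L(G))\ge \frac{m}{51\chi_k(L(G))}$.
   Context: All graphs are finite, simple and undirected. A triangulation is a maximal planar graph. $L(G)$ is the line graph of $G$. For a graph $H$, $D_i(H)$ denotes the set of vertices of degree $i$ in $H$. For an integer $k\ge 0$, a set $S\subseteq V(H)$ is $k$-independent if $H[S]$ has maximum degree at most $k$; a regular $k$-independent set is a $k$-independent set contained in some $D_i(H)$; $\alpha_{k-reg}(H)$ is the maximum cardinality of a regular $k$-independent set of $H$. The $k$-chromatic number $\chi_k(H)$ is the minimum number of colors in a coloring of $V(H)$ such that each color class induces a subgraph of maximum degree at most $k$. *)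

(* Defs.v *)
From HB Require Import structures.
From mathcomp Require Import all_boot all_order all_algebra.
From mathcomp Require Import reals.
Set Implicit Arguments. Unset Strict Implicit. Unset Printing Implicit Defensive.
Import Order.TTheory GRing.Theory Num.Theory.

Record sgraph := SGraph {
  vertex :> finType;
  adj : rel vertex;
  adj_sym : symmetric adj;
  adj_irrefl : irreflexive adj }.

Section Graph.
Variable H : sgraph.

Definition edges : {set {set H}} :=
  [set A | [exists x, exists y, adj x y && (A == [set x; y])]].

Definition degree (x : H) : nat := #|[set y | adj x y]|.

Definition min_degree_ge (d : nat) : Prop := forall x : H, d <= degree x.

Definition D (i : nat) : {set H} := [set x | degree x == i].

Definition k_independent (k : nat) (S : {set H}) : bool :=
  [forall x in S, #|[set y in S | adj x y]| <= k].

(* Every degree is at most #|H|, so bounding i loses nothing. *)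
Definition regular_k_independent (k : nat) (S : {set H}) : bool :=
  k_independent k S && [exists i : 'I_(#|H|.+1), S \subset D i].

Definition alpha_reg (k : nat) : nat :=
  \max_(S : {set H} | regular_k_independent k S) #|S|.

Definition k_colorable (k c : nat) : bool :=
  [exists f : {ffun H -> 'I_c},
    [forall i : 'I_c, k_independent k [set x | f x == i]]].

Lemma k_colorable_exists (k : nat) : exists c, k_colorable k c.
Proof.
exists #|H|; apply/existsP; exists [ffun x => enum_rank x].
apply/forallP=> i; apply/forall_inP=> x; rewrite inE ffunE => /eqP xi.
rewrite (_ : [set y in _ | adj x y] = set0) ?cards0 //.
apply/setP=> y; rewrite !inE ffunE -xi; apply/negP=> /andP[/eqP/enum_rank_inj->].
by rewrite adj_irrefl.
Qed.

Definition chi (k : nat) : nat := ex_minn (k_colorable_exists k).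

End Graph.

Section LineGraph.
Variable G : sgraph.

Definition line_vertex := {A : {set G} | A \in edges G}.

Definition line_adj : rel line_vertex :=
  [rel A B | (A != B) && (val A :&: val B != set0)].

Lemma line_adj_sym : symmetric line_adj.
Proof. by move=> A B; rewrite /line_adj /= eq_sym setIC. Qed.

Lemma line_adj_irrefl : irreflexive line_adj.
Proof. by move=> A; rewrite /line_adj /= eqxx. Qed.

Definition line_graph : sgraph := SGraph line_adj_sym line_adj_irrefl.

End LineGraph.

(* Planarity is the existence of a crossing-free drawing in the real plane
   whose edges are simple polygonal arcs, as in the textbooks of Diestel and
   West. A polygonal arc is given by the sequence of its successive corners. *)
Section Planar.
Variable R : realType.
Local Open Scope ring_scope.

Definition arc_pt (s : seq 'rV[R]_2) (i : nat) (t : R) : 'rV[R]_2 :=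
  (1 - t) *: s`_i + t *: s`_i.+1.

Definition on_arc (s : seq 'rV[R]_2) (p : 'rV[R]_2) : Prop :=
  exists i t, [/\ (i.+1 < size s)%N, 0 <= t <= 1 & p = arc_pt s i t].

(* Injectivity of the parametrisation i + t |-> arc_pt s i t of the whole arc
   by [0, size s - 1]. *)
Definition simple_arc (s : seq 'rV[R]_2) : Prop :=
  forall (i j : nat) (t u : R), (i.+1 < size s)%N -> (j.+1 < size s)%N ->
    0 <= t <= 1 -> 0 <= u <= 1 ->
    arc_pt s i t = arc_pt s j u -> i%:R + t = j%:R + u.

Record plane_drawing (G : sgraph) (f : G -> 'rV[R]_2)
    (c : {set G} -> seq 'rV[R]_2) : Prop := PlaneDrawing {
  drawing_inj : injective f;
  drawing_simple : forall A, A \in edges G ->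
    (1 < size (c A))%N /\ simple_arc (c A);
  drawing_ends : forall A, A \in edges G ->
    exists x y, [/\ A = [set x; y], head 0 (c A) = f x & last 0 (c A) = f y];
  drawing_vertex : forall A z, A \in edges G -> on_arc (c A) (f z) -> z \in A;
  drawing_noncrossing : forall A B p, A \in edges G -> B \in edges G -> A != B ->
    on_arc (c A) p -> on_arc (c B) p -> exists2 z, z \in A :&: B & p = f z }.

Definition planar (G : sgraph) : Prop :=
  exists f c, @plane_drawing G f c.

(* Maximality is among the simple graphs on the same vertex set. *)
Definition triangulation (G : sgraph) : Prop :=
  planar G /\
  forall (e : rel G) (e_sym : symmetric e) (e_irrefl : irreflexive e),
    subrel (@adj G) e -> planar (SGraph e_sym e_irrefl) -> e =2 @adj G.

End Planar.

(* Main.v *)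
Require Import Defs.
From HB Require Import structures.
From mathcomp Require Import all_boot all_order all_algebra.
From mathcomp Require Import reals.
From mathcomp Require Import ring lra zify.
Set Implicit Arguments. Unset Strict Implicit. Unset Printing Implicit Defensive.
Import Order.TTheory GRing.Theory Num.Theory.
Local Open Scope ring_scope.

(** Summing [1/deg u + 1/deg v] over the edges [uv] gives the number [n] of
    vertices, and planarity gives [m <= 3 n], so the average of this quantity is
    at least [1/3]. With minimum degree [d] an edge of degree sum [w] contributes
    at most [1/d + 1/(w - d)]; for [d = 4] or [5] this is bounded away from [1/3]
    for large [w], so the edges cannot be spread thinly over all values of [w],
    which are, up to a shift, the degrees in the line graph. A large degree class
    is then split by an optimal colouring.

    The bound [m <= 3 n] comes from a mod 2 Jordan argument. Shear the drawing so
    that distinct corners have distinct abscissas. For an even edge set [z], the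
    parity of the number of segments of [z] above a point is constant along the
    left side of each dart and passes to the next dart around its target; the
    parities on the two sides of an edge differ exactly when the edge is in [z].
    Call darts equivalent when all these parities agree. Each of the [F] classes
    contains three consecutive darts, so [3 F <= 2 m], and [z] is determined by
    its parities on the classes, so there are at most [2 ^ F] even sets. There
    are at least [2 ^ (m - n)] of them, whence [m <= n + 2 m / 3]. *)

(** * Segments in the plane *)

Section Segments.
Variables (R : realFieldType) (S : finType) (l r icpt slope : S -> R).

Definition ht (s : S) (x : R) : R := icpt s + slope s * x.
Definition seg_end (s : S) (b : bool) : R := if b then r s else l s.

Hypothesis lt_lr : forall s, l s < r s.
Hypothesis noncrossing : forall s s' x, s != s' ->
  l s <= x <= r s -> l s' <= x <= r s' -> ht s x = ht s' x ->
  (x == l s) || (x == r s).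
Hypothesis ht_end : forall s s' b b', seg_end s b = seg_end s' b' ->
  ht s (seg_end s b) = ht s' (seg_end s' b').

(** Zero boundary mod 2. Since [ht_end] makes an abscissa determine the end point, sets [U] of
    abscissas stand for sets of points; allowing any [U], not only singletons, lets a whole strip be
    tested at once. *)
Definition closed_chain (z : {set S}) : Prop := forall U : pred R,
  \big[addb/false]_(s in z) (U (l s) (+) U (r s)) = false.

Definition passes_over (s : S) (x h : R) : bool := (l s < x < r s) && (h < ht s x).

Definition parity_over (z : {set S}) (x h : R) : bool :=
  \big[addb/false]_(s in z) passes_over s x h.

(** The parity above [s] immediately to the right of its left end: besides the segments passing over
    that end, the steeper segments starting there count. In [above_right], near the right end, it is
    the flatter ones. *)
Definition above_left (z : {set S}) (s : S) : bool :=
  parity_over z (l s) (ht s (l s))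
  (+) \big[addb/false]_(s' in z) ((l s' == l s) && (slope s < slope s')).

Definition above_right (z : {set S}) (s : S) : bool :=
  parity_over z (r s) (ht s (r s))
  (+) \big[addb/false]_(s' in z) ((r s' == r s) && (slope s' < slope s)).

Lemma ht_sub s x x0 : ht s x - ht s x0 = slope s * (x - x0).
Proof. by rewrite /ht; ring. Qed.

Lemma ht_neq s s' x : s != s' -> l s < x < r s -> l s' <= x <= r s' ->
  ht s x != ht s' x.
Proof.
move=> ns /andP[lx xr] x'; apply/eqP => e.
have := noncrossing ns _ x' e; rewrite (ltW lx) (ltW xr) => /(_ isT).
by rewrite (gt_eqF lx) (lt_eqF xr).
Qed.

(** If the order of the heights changed, the affine difference [g] would vanish at an explicit point
    [u] between [x] and [x0], where the segments would cross. *)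
Lemma ht_lt_transport s s' x x0 : s != s' ->
    l s < x0 < r s -> l s' < x0 < r s' -> l s <= x <= r s -> l s' <= x <= r s' ->
  ht s x < ht s' x -> ht s x0 < ht s' x0.
Proof.
move=> ns hx0 hx0' hx hx' lt1; rewrite ltNge; apply/negP => le0.
pose g u := ht s' u - ht s u.
have g0 : g x0 <= 0 by rewrite /g subr_le0.
have g1 : 0 < g x by rewrite /g subr_gt0.
pose t := g x / (g x - g x0).
have dpos : 0 < g x - g x0 by lra.
have tpos : 0 < t by rewrite divr_gt0.
have t1 : t <= 1 by rewrite ler_pdivrMr // mul1r; lra.
pose u := x + t * (x0 - x).
have ht1 : t * (g x - g x0) = g x by rewrite /t mulfVK // gt_eqF.
have gu : g u = 0.
  have -> : g u = g x - t * (g x - g x0) by rewrite /g /u /ht; ring.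
  by rewrite ht1 subrr.
(* As [t] is positive, [u] lies strictly inside both spans even when [x] is an end. *)
have convl a : a <= x -> a < x0 -> a < u.
  move=> ax a0; rewrite /u.
  have -> : x + t * (x0 - x) = a + ((1 - t) * (x - a) + t * (x0 - a)) by ring.
  rewrite ltrDl; apply: ltr_wpDl; first by apply: mulr_ge0; lra.
  by apply: mulr_gt0; lra.
have convr a : x <= a -> x0 < a -> u < a.
  move=> ax a0; rewrite /u.
  have -> : x + t * (x0 - x) = a - ((1 - t) * (a - x) + t * (a - x0)) by ring.
  rewrite gtrBl; apply: ltr_wpDl; first by apply: mulr_ge0; lra.
  by apply: mulr_gt0; lra.
move/andP: hx0 => [a1 a2]; move/andP: hx0' => [b1 b2].
move/andP: hx => [c1 c2]; move/andP: hx' => [d1 d2].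
have : ht s u != ht s' u.
  by apply: ht_neq => //; rewrite ?convl ?convr // (ltW (convl _ d1 b1)) (ltW (convr _ d2 b2)).
by move/eqP; apply; move: gu; rewrite /g; lra.
Qed.

Lemma ht_lt_const s s' x x0 : s != s' ->
    l s < x0 < r s -> l s' < x0 < r s' -> l s <= x <= r s -> l s' <= x <= r s' ->
  ht s x != ht s' x -> (ht s x < ht s' x) = (ht s x0 < ht s' x0).
Proof.
move=> ns h1 h2 h3 h4 ne; apply/idP/idP; first exact: ht_lt_transport.
move=> lt0; rewrite lt_neqAle ne leNgt; apply/negP => lt1.
have := @ht_lt_transport s' s x x0; rewrite eq_sym => /(_ ns h2 h1 h4 h3 lt1).
by rewrite ltNge (ltW lt0).
Qed.

Lemma slope_ltl s s' x0 : l s = l s' -> l s < x0 ->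
  (slope s < slope s') = (ht s x0 < ht s' x0).
Proof.
move=> e lx; have := @ht_end s s' false false e; rewrite /= -e => eh.
have h1 := ht_sub s x0 (l s); have h2 := ht_sub s' x0 (l s).
rewrite -(ltr_pM2r (_ : 0 < x0 - l s)) ?subr_gt0 // -h1 -h2 eh; apply/idP/idP; lra.
Qed.

Lemma slope_ltr s s' x0 : r s = r s' -> x0 < r s ->
  (slope s' < slope s) = (ht s x0 < ht s' x0).
Proof.
move=> e lx; have := @ht_end s s' true true e; rewrite /= -e => eh.
have h1 := ht_sub s (r s) x0; have h2 := ht_sub s' (r s) x0.
rewrite -(ltr_pM2r (_ : 0 < r s - x0)) ?subr_gt0 // -h1 -h2 eh; apply/idP/idP; lra.
Qed.

Lemma overlap s s' : l s < r s' -> l s' < r s ->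
  exists m, l s < m < r s /\ l s' < m < r s'.
Proof.
move=> c1 c2; have h1 := lt_lr s; have h2 := lt_lr s'.
exists ((Num.max (l s) (l s') + Num.min (r s) (r s')) / 2).
by rewrite maxEle minEle; case: (leP (l s) (l s')) => ?; case: (leP (r s) (r s')) => ?; split; lra.
Qed.

Lemma slope_neq_l s s' : s != s' -> l s = l s' -> slope s != slope s'.
Proof.
move=> ns e; apply/eqP => es.
have h1 := lt_lr s; have h2 := lt_lr s'.
have [||m [hm1 hm2]] := @overlap s s'; [lra..|].
have /andP[m1 _] := hm1.
have hm2' : l s' <= m <= r s' by lra.
have := ht_neq ns hm1 hm2'; have := slope_ltl e m1; have := slope_ltl (esym e) (_ : l s' < m).
rewrite es ltxx -e m1 => /(_ isT); case: ltgtP => //.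
Qed.

Lemma slope_neq_r s s' : s != s' -> r s = r s' -> slope s != slope s'.
Proof.
move=> ns e; apply/eqP => es.
have h1 := lt_lr s; have h2 := lt_lr s'.
have [||m [hm1 hm2]] := @overlap s s'; [lra..|].
have /andP[_ m1] := hm1.
have hm2' : l s' <= m <= r s' by lra.
have := ht_neq ns hm1 hm2'; have := slope_ltr e m1; have := slope_ltr (esym e) (_ : m < r s').
rewrite es ltxx -e m1 => /(_ isT); case: ltgtP => //.
Qed.

(* Membership in the open strip above [s]; inside it a segment [s'] has as many
   ends, mod 2, as it has crossings with the two vertical sides. *)
Definition in_strip (s : S) (x : R) : bool :=
  (l s < x < r s) && [exists s', exists b, (seg_end s' b == x) && (ht s x < ht s' x)].

Lemma in_strip_end s s' b : in_strip s (seg_end s' b) =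
  (l s < seg_end s' b < r s) && (ht s (seg_end s' b) < ht s' (seg_end s' b)).
Proof.
congr andb; apply/existsP/idP => [[s1 /existsP[b1 /andP[/eqP e1]]]|h].
  by rewrite -(ht_end e1) e1.
by exists s'; apply/existsP; exists b; rewrite eqxx.
Qed.

(** If the spans of [s] and [s'] do not overlap, every term vanishes. Otherwise [s'] stays on one
    side of [s] over the common span, so all height tests reduce to the one at an inner abscissa
    [m], and a comparison of the ends remains. *)
Lemma strip_crossings s s' :
  passes_over s' (l s) (ht s (l s)) (+) ((l s' == l s) && (slope s < slope s'))
  (+) (passes_over s' (r s) (ht s (r s)) (+) ((r s' == r s) && (slope s' < slope s)))
  = in_strip s (l s') (+) in_strip s (r s').
Proof.
rewrite (in_strip_end s s' false) (in_strip_end s s' true) /= /passes_over.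
have [->|ns] := eqVneq s s'.
  by rewrite !ltxx !andbF.
have h1 := lt_lr s; have h2 := lt_lr s'.
have [rl|] := boolP (r s' <= l s).
  have -> : (l s < r s') = false by lra.
  have -> : (l s < l s') = false by lra.
  have -> : (r s < r s') = false by lra.
  have -> : (l s' == l s) = false by lra.
  have -> : (r s' == r s) = false by lra.
  by rewrite !andbF.
rewrite -ltNge => lr.
have [rl'|] := boolP (r s <= l s').
  have -> : (l s' < l s) = false by lra.
  have -> : (l s' < r s) = false by lra.
  have -> : (r s' < r s) = false by lra.
  have -> : (l s' == l s) = false by lra.
  have -> : (r s' == r s) = false by lra.
  by rewrite !andbF.
rewrite -ltNge => lr'.
have [m [hm1 hm2]] := overlap lr lr'.
have key x : l s < x < r s /\ l s' <= x <= r s' \/ l s <= x <= r s /\ l s' < x < r s' ->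
    (ht s x < ht s' x) = (ht s m < ht s' m).
  case=> -[c1 c2].
    have c3 : l s <= x <= r s by lra.
    by apply: ht_lt_const => //; apply: ht_neq.
  have c3 : l s' <= x <= r s' by lra.
  by apply: ht_lt_const => //; rewrite eq_sym; apply: ht_neq => //; rewrite eq_sym.
have -> : (l s' < l s < r s') && (ht s (l s) < ht s' (l s)) (+)
    (l s' == l s) && (slope s < slope s') =
    (l s' <= l s) && (ht s m < ht s' m).
  case: (ltgtP (l s') (l s)) => //= c.
  - by rewrite lr /= addbF key //; right; split; lra.
  - by rewrite (slope_ltl (x0 := m)) //; lra.
have -> : (l s' < r s < r s') && (ht s (r s) < ht s' (r s)) (+)
    (r s' == r s) && (slope s' < slope s) =
    (r s <= r s') && (ht s m < ht s' m).
  rewrite lr' /=; case: (ltgtP (r s') (r s)) => //= c.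
  - by rewrite addbF key //; right; split; lra.
  - by rewrite (slope_ltr (x0 := m)) //; lra.
have -> : (l s < l s' < r s) && (ht s (l s') < ht s' (l s')) =
    ~~ (l s' <= l s) && (ht s m < ht s' m).
  rewrite lr' -ltNge andbT; case: (ltP (l s) (l s')) => //= c.
  by rewrite key //; left; split; lra.
have -> : (l s < r s' < r s) && (ht s (r s') < ht s' (r s')) =
    ~~ (r s <= r s') && (ht s m < ht s' m).
  rewrite lr -ltNge /=; case: (ltP (r s') (r s)) => //= c.
  by rewrite key //; left; split; lra.
by case: (l s' <= l s); case: (r s <= r s'); case: (ht s m < ht s' m).
Qed.

(** Summing [strip_crossings] over [z] leaves the ends of [z] in the strip above [s]; their number
    is even, by [closed_chain] for the predicate [in_strip s]. *)
Lemma above_left_right z s : closed_chain z -> above_left z s = above_right z s.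
Proof.
move=> cz; have e : above_left z s (+) above_right z s =
   \big[addb/false]_(s' in z) (in_strip s (l s') (+) in_strip s (r s')).
  rewrite /above_left /above_right /parity_over -!big_split /=.
  by apply: eq_bigr => s' _; rewrite -strip_crossings.
by move: e; rewrite cz; case: (above_left z s); case: (above_right z s).
Qed.

(* The dart (s, b) runs along s towards seg_end s b; forward darts have the
   upper side of s on their left. *)
Definition left_parity (z : {set S}) (s : S) (b : bool) : bool :=
  above_left z s (+) (~~ b && (s \in z)).

Lemma left_parity_rev z s b :
  left_parity z s b (+) left_parity z s (~~ b) = (s \in z).
Proof. by rewrite /left_parity; case: above_left; case: b; case: (s \in z). Qed.

Lemma xor_set1 (z : {set S}) s : \big[addb/false]_(s' in z) (s' == s) = (s \in z).
Proof.
have [sz|sz] := boolP (s \in z).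
  rewrite (bigD1 s) //= eqxx big1 // => i /andP[_ /negPf->] //.
by rewrite big1 // => i iz; apply/negbTE; apply: contraNneq sz => <-.
Qed.

Lemma closed_chain_ends (z : {set S}) x : closed_chain z ->
  \big[addb/false]_(s in z) (l s == x) = \big[addb/false]_(s in z) (r s == x).
Proof.
by move/(_ (pred1 x)); rewrite big_split /=; do 2![case: (\big[addb/false]_(s in z) _)].
Qed.

(** This and the next three lemmas read the parity off at the source ([leave]) or the target
    ([enter]) of a dart running right or left. A leftward dart has the lower side on its left, so
    [s] itself counts and the slope comparison becomes weak. *)
Lemma left_parity_leave_right z s :
  left_parity z s true = parity_over z (l s) (ht s (l s))
    (+) \big[addb/false]_(s' in z) ((l s' == l s) && (slope s < slope s')).
Proof. by rewrite /left_parity addbF. Qed.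

Lemma left_parity_enter_left z s :
  left_parity z s false = parity_over z (l s) (ht s (l s))
    (+) \big[addb/false]_(s' in z) ((l s' == l s) && (slope s <= slope s')).
Proof.
rewrite /left_parity /above_left -addbA -[s \in z](xor_set1 z s) -big_split.
congr addb; apply: eq_bigr => s' _ /=; rewrite le_eqVlt.
have [->|ns] := eqVneq s' s; first by rewrite !eqxx ltxx.
rewrite addbF; have [e|//] := eqVneq (l s') (l s).
by rewrite eq_sym (negPf (slope_neq_l ns e)).
Qed.

Lemma left_parity_enter_right z s : closed_chain z ->
  left_parity z s true = parity_over z (r s) (ht s (r s))
    (+) \big[addb/false]_(s' in z) ((r s' == r s) && (slope s' < slope s)).
Proof. by move=> cz; rewrite /left_parity above_left_right // addbF. Qed.

Lemma left_parity_leave_left z s : closed_chain z ->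
  left_parity z s false = parity_over z (r s) (ht s (r s))
    (+) \big[addb/false]_(s' in z) ((r s' == r s) && (slope s' <= slope s)).
Proof.
move=> cz.
rewrite /left_parity above_left_right // /above_right -addbA -[s \in z](xor_set1 z s) -big_split.
congr addb; apply: eq_bigr => s' _ /=; rewrite le_eqVlt.
have [->|ns] := eqVneq s' s; first by rewrite !eqxx ltxx.
rewrite addbF; have [e|//] := eqVneq (r s') (r s).
by rewrite (negPf (slope_neq_r ns e)).
Qed.

Lemma parity_over_end z s s' b b' : seg_end s b = seg_end s' b' ->
  parity_over z (seg_end s b) (ht s (seg_end s b))
  = parity_over z (seg_end s' b') (ht s' (seg_end s' b')).
Proof. by move=> e; rewrite (ht_end e) e. Qed.

Lemma slope_max (P : pred S) s0 : P s0 ->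
  exists2 s, P s & forall s', P s' -> slope s' <= slope s.
Proof.
move=> P0; exists [arg max_(i > s0 | P i) slope i]%O; case: arg_maxP => //.
Qed.

(* The successor of a dart is the next segment clockwise around its target. *)
Lemma next_dart s b : (exists s1 b1, s1 != s /\ seg_end s1 b1 = seg_end s b) ->
  exists s' b', [/\ s' != s, seg_end s' (~~ b') = seg_end s b &
    forall z, closed_chain z -> left_parity z s b = left_parity z s' b'].
Proof.
move=> [s1 [b1 [ns1 e1]]]; case: b e1 => /= e1.
(* Target at the right end: left of it, flatter segments lie higher, so the nearest one above [s]
   has the largest slope below that of [s]. *)
- have [s2 /andP[/eqP e2 l2]|none] := pickP (fun s2 => (r s2 == r s) && (slope s2 < slope s)).
    have [|s' /andP[/eqP e' l'] mx] := slope_max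
      (P := fun s2 => (r s2 == r s) && (slope s2 < slope s)) (s0 := s2); first by rewrite e2 eqxx.
    exists s', false; split => // [|z cz]; first by apply: contraTneq l' => ->; rewrite ltxx.
    rewrite left_parity_enter_right // left_parity_leave_left //.
    rewrite (@parity_over_end z s s' true true (esym e')); congr addb; apply: eq_bigr => t _.
    rewrite e'; have [e|//] := eqVneq (r t) (r s) => /=; apply/idP/idP => [lt|le].
      by apply: mx; rewrite e eqxx.
    exact: le_lt_trans le l'.
  have zero z : \big[addb/false]_(s' in z) ((r s' == r s) && (slope s' < slope s)) = false.
    by rewrite big1 // => t _; rewrite none.
  (* Nothing above [s] on the left: the turn goes on to the topmost segment on the right of the
     target. *)
  have [s2 /eqP e2|noner] := pickP (fun s2 => l s2 == r s).
    have [|s' /eqP e' mx] := slope_max (P := fun s2 => l s2 == r s) (s0 := s2); first exact/eqP.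
    exists s', true; split => // [|z cz].
      by apply: contra_eq_neq e' => ->; rewrite lt_eqF.
    rewrite left_parity_enter_right // left_parity_leave_right // zero.
    rewrite (@parity_over_end z s s' true false (esym e')); congr addb.
    rewrite big1 // => t _; rewrite e'; apply/negbTE/negP => /andP[/mx le].
    by rewrite ltNge le.
  (* Nothing on the right: the turn wraps around to the bottom segment on the left, which is not [s]
     because [s1] lies below [s]. All segments of [z] at the target are now crossed, an even
     number. *)
  have e1r : r s1 = r s by case: b1 e1 => //= e; have := noner s1; rewrite /= e eqxx.
  have [|s' /eqP e' mx] := slope_max (P := fun s2 => r s2 == r s) (s0 := s1); first exact/eqP.
  exists s', false; split => // [|z cz].
    apply: contraFneq (none s1) => es; rewrite /= e1r eqxx /=.
    by rewrite lt_neqAle (slope_neq_r ns1 e1r) -es mx // e1r.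
  rewrite left_parity_enter_right // left_parity_leave_left // zero.
  rewrite (@parity_over_end z s s' true true (esym e')); congr addb.
  transitivity (\big[addb/false]_(t in z) (r t == r s)).
    by rewrite -closed_chain_ends // big1 // => t _; exact: noner.
  apply: eq_bigr => t _; rewrite e'; case: eqVneq => //= e.
  by rewrite mx // e.
(* Target at the left end: the same three cases, now starting downwards from [s], then the bottom
   segment on the left, then the topmost on the right. *)
- have [s2 /andP[/eqP e2 l2]|none] := pickP (fun s2 => (l s2 == l s) && (slope s2 < slope s)).
    have [|s' /andP[/eqP e' l'] mx] := slope_max
      (P := fun s2 => (l s2 == l s) && (slope s2 < slope s)) (s0 := s2); first by rewrite e2 eqxx.
    exists s', true; split => // [|z cz]; first by apply: contraTneq l' => ->; rewrite ltxx.
    rewrite left_parity_enter_left // left_parity_leave_right //.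
    rewrite (@parity_over_end z s s' false false (esym e')); congr addb; apply: eq_bigr => t _.
    rewrite e'; have [e|//] := eqVneq (l t) (l s) => /=; apply/idP/idP => [le|lt].
      exact: lt_le_trans l' le.
    by rewrite leNgt; apply/negP => lt2; move: lt; rewrite ltNge mx // e eqxx.
  have all z : \big[addb/false]_(s' in z) ((l s' == l s) && (slope s <= slope s'))
      = \big[addb/false]_(s' in z) (l s' == l s).
    apply: eq_bigr => t _; case: eqVneq (none t) => //= e; rewrite ltNge.
    by move/negbFE.
  have [s2 /eqP e2|nonel] := pickP (fun s2 => r s2 == l s).
    have [|s' /eqP e' mx] := slope_max (P := fun s2 => r s2 == l s) (s0 := s2); first exact/eqP.
    exists s', false; split => // [|z cz].
      by apply: contra_eq_neq e' => ->; rewrite gt_eqF.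
    rewrite left_parity_enter_left // left_parity_leave_left // all.
    rewrite (@parity_over_end z s s' false true (esym e')); congr addb.
    rewrite closed_chain_ends //; apply: eq_bigr => t _; rewrite e'; case: eqVneq => //= e.
    by rewrite mx // e.
  have e1l : l s1 = l s by case: b1 e1 => //= e; have := nonel s1; rewrite /= e eqxx.
  have [|s' /eqP e' mx] := slope_max (P := fun s2 => l s2 == l s) (s0 := s1); first exact/eqP.
  exists s', true; split => // [|z cz].
    apply: contraFneq (none s1) => es; rewrite /= e1l eqxx /=.
    by rewrite lt_neqAle (slope_neq_l ns1 e1l) -es mx // e1l.
  rewrite left_parity_enter_left // left_parity_leave_right // all.
  rewrite (@parity_over_end z s s' false false (esym e')); congr addb.
  rewrite closed_chain_ends // big1; last by move=> t _; exact: nonel.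
  rewrite big1 // => t _; rewrite e'; apply/negbTE/negP => /andP[/mx le].
  by rewrite ltNge le.
Qed.

End Segments.

(** * Counting faces *)

Section FaceCount.
Variables (E V : finType) (src tgt : E -> bool -> V).

Definition odd_degree (z : {set E}) (v : V) : bool :=
  \big[addb/false]_(e in z) ((src e true == v) (+) (tgt e true == v)).

(** The cycle space over the field with two elements. *)
Definition even_sets : {set {set E}} := [set z | [forall v, ~~ odd_degree z v]].

Definition xor_sets (z z' : {set E}) : {set E} := [set e | (e \in z) (+) (e \in z')].

Lemma xor_setsK z : involutive (xor_sets z).
Proof. by move=> z'; apply/setP => e; rewrite !inE addKb. Qed.

Lemma odd_degree_xor z z' v :
  odd_degree (xor_sets z z') v = odd_degree z v (+) odd_degree z' v.
Proof.
rewrite /odd_degree !(big_mkcond (fun e => e \in _)) -big_split /=.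
by apply: eq_bigr => e _; rewrite inE; case: (e \in z); case: (e \in z'); rewrite ?addbF ?addbb.
Qed.

(** The nonempty fibres of the boundary map [bd] are translates of [even_sets], and [bd] has at most
    [2 ^ #|V|] values. *)
Lemma card_even_sets : (2 ^ #|E| <= 2 ^ #|V| * #|even_sets|)%N.
Proof.
pose bd z := [ffun v => odd_degree z v].
have -> : (2 ^ #|E| = \sum_(z : {set E}) 1)%N.
  by rewrite sum1_card -[RHS]cardsT -powersetT card_powerset cardsT.
rewrite (partition_big bd predT) //=.
have -> : (2 ^ #|V| = #|{ffun V -> bool}|)%N by rewrite card_ffun card_bool.
rewrite -sum_nat_const; apply: leq_sum => y _.
rewrite sum1dep_card.
have [-> |[z0]] := set_0Vmem [set z | bd z == y]; first by rewrite cards0.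
rewrite inE => /eqP e0.
rewrite -(card_imset _ (can_inj (xor_setsK z0))); apply: subset_leq_card.
apply/subsetP => _ /imsetP[z + ->]; rewrite !inE => /eqP ez.
apply/forallP => v; rewrite odd_degree_xor.
have -> : odd_degree z0 v = odd_degree z v by have /ffunP/(_ v) := etrans e0 (esym ez); rewrite !ffunE.
by rewrite addbb.
Qed.

Variable L : {set E} -> E -> bool -> bool.
Hypothesis L_rev : forall z e b, z \in even_sets -> L z e b (+) L z e (~~ b) = (e \in z).
Hypothesis src_neq_tgt : forall e b, tgt e b != src e b.
Hypothesis L_next : forall e b, exists e' b', [/\ src e' b' = tgt e b,
  tgt e' b' != src e b & forall z, z \in even_sets -> L z e b = L z e' b'].

(** A face is coded by its odd even-sets, so darts share a face exactly when no even set separates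
    their left sides. *)
Definition face (d : E * bool) : {set {set E}} := [set z in even_sets | L z d.1 d.2].

Definition faces : {set {set {set E}}} := face @: [set: E * bool].

(** A dart and its next two successors have the same face, and their sources are distinct because a
    successor never returns to the source of its predecessor. *)
Lemma face_size y : y \in faces -> (3 <= #|[set d | face d == y]|)%N.
Proof.
case/imsetP => -[e1 b1] _ ->.
have face_eq e b e' b' : (forall z, z \in even_sets -> L z e b = L z e' b') ->
    face (e', b') = face (e, b).
  by move=> h; apply/setP => z; rewrite !inE /=; case: (boolP [forall _, _]) => //= hz; rewrite h ?inE.
have [e2 [b2 [s2 t2 L2]]] := L_next e1 b1.
have [e3 [b3 [s3 t3 L3]]] := L_next e2 b2.
have /subset_leq_card : [set (e1, b1); (e2, b2); (e3, b3)] \subset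
    [set d | face d == face (e1, b1)].
  apply/subsetP => d; rewrite !inE => /orP[/orP[]|] /eqP ->; rewrite ?eqxx //.
    by rewrite (face_eq _ _ _ _ L2).
  by rewrite (face_eq _ _ _ _ L3) (face_eq _ _ _ _ L2).
apply: leq_trans; rewrite setUC cardsU1 cards2 !inE.
have neq d d' : src d.1 d.2 != src d'.1 d'.2 -> (d != d') = true by move=> h; apply: contraNneq h => ->.
have n12 : (e1, b1) != (e2, b2) by rewrite neq //= s2 eq_sym src_neq_tgt.
have n31 : (e3, b3) != (e1, b1) by rewrite neq //= s3.
have n32 : (e3, b3) != (e2, b2) by rewrite neq //= s3 src_neq_tgt.
by rewrite n12 (negPf n31) (negPf n32).
Qed.

Lemma card_faces : (3 * #|faces| <= 2 * #|E|)%N.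
Proof.
have -> : (2 * #|E| = #|[set: E * bool]|)%N by rewrite cardsT card_prod card_bool mulnC.
rewrite -[X in (_ <= X)%N]sum1_card (partition_big_imset face) /= mulnC -sum_nat_const.
apply: leq_sum => y yf; have := face_size yf; rewrite -sum1_card.
by move/leq_trans; apply; rewrite (eq_bigl (fun d => (d \in setT) && (face d == y))) // => d; rewrite !inE.
Qed.

(* An even set is recovered from the faces it winds around. *)
Lemma card_even_sets_faces : (#|even_sets| <= 2 ^ #|faces|)%N.
Proof.
pose phi (z : {set E}) := [set y in faces | z \in y].
rewrite -card_powerset -(@card_in_imset _ _ phi even_sets).
  by apply: subset_leq_card; apply/subsetP => _ /imsetP[z _ ->]; rewrite powersetE; apply/subsetP => y; rewrite inE => /andP[].
move=> z z' hz hz' eqphi.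
have Leq e b : L z e b = L z' e b.
  have /setP/(_ (face (e, b))) := eqphi; rewrite !inE (imset_f face) ?inE //=.
  by rewrite inE in hz; rewrite inE in hz'; rewrite hz hz'.
by apply/setP => e; rewrite -(L_rev e true hz) -(L_rev e true hz') !Leq.
Qed.

Lemma card_edges_le : (#|E| <= 3 * #|V|)%N.
Proof.
have : (2 ^ #|E| <= 2 ^ (#|V| + #|faces|))%N.
  rewrite expnD; apply: leq_trans card_even_sets _.
  by rewrite leq_mul2l card_even_sets_faces orbT.
by rewrite leq_exp2l // => h; have := card_faces; lia.
Qed.

End FaceCount.

(** * Polygonal drawings *)

Section Shear.
Variables (R : realFieldType) (lam : R).

Definition px (p : 'rV[R]_2) : R := p 0 0 + lam * p 0 1.
Definition py (p : 'rV[R]_2) : R := p 0 1.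

Lemma pxy_inj p q : px p = px q -> py p = py q -> p = q.
Proof.
rewrite /px /py => hx hy; rewrite hy in hx; move/addIr: hx => hx.
apply/rowP => i; have [->|->] : i = 0 \/ i = 1; last 2 first.
- exact: hx.
- exact: hy.
by case: i => [[|[|//]]] h; [left|right]; apply: val_inj.
Qed.

End Shear.

Lemma seq_avoid (R : realFieldType) (s : seq R) : exists x, x \notin s.
Proof.
exists (1 + \sum_(b <- s) `|b|); apply/negP => xs.
have : `|1 + \sum_(b <- s) `|b| | <= \sum_(b <- s) `|b|.
  by rewrite [X in _ <= X](big_rem _ xs) /= lerDl sumr_ge0.
rewrite ger0_norm; last by rewrite addr_ge0 ?sumr_ge0.
lra.
Qed.

(** Each pair of points with different ordinates rules out one value of [lam]; pairs with equal
    ordinates are separated by every shear. *)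
Lemma generic_shear (R : realFieldType) (ps : seq 'rV[R]_2) :
  exists lam, forall p q, p \in ps -> q \in ps -> px lam p = px lam q -> p = q.
Proof.
have [lam hlam] := seq_avoid [seq (q 0 0 - p 0 0) / (p 0 1 - q 0 1) | p : 'rV[R]_2 <- ps, q : 'rV[R]_2 <- ps].
exists lam => p q hp hq e; have [e1|n1] := eqVneq (p 0 1) (q 0 1); first exact: pxy_inj e e1.
case/negP: hlam; apply/allpairsP; exists (p, q); split => //=.
rewrite -subr_eq0 in n1; apply: (mulIf n1); rewrite mulfVK //.
by move: e; rewrite /px; lra.
Qed.

(** * The segments of a sheared drawing and the parities along its edges *)

Section Drawing.
Variables (R : realType) (G : sgraph) (f : G -> 'rV[R]_2) (c : {set G} -> seq 'rV[R]_2).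
Hypothesis drawing : plane_drawing f c.
Variable lam : R.
Local Notation E := (line_vertex G).
Local Notation X := (px lam).
Local Notation Y := (@py R).
Hypothesis generic : forall (A B : E) p q,
  p \in c (val A) -> q \in c (val B) -> X p = X q -> p = q.

Definition arc_len (A : E) : nat := (size (c (val A))).-1.

Lemma size_arc (A : E) : size (c (val A)) = (arc_len A).+1.
Proof.
by rewrite /arc_len prednK //; have [/ltnW] := drawing_simple drawing (valP A).
Qed.

Lemma arc_len_gt0 (A : E) : (0 < arc_len A)%N.
Proof. by have [] := drawing_simple drawing (valP A); rewrite size_arc. Qed.

Definition corner (A : E) (i : nat) : 'rV[R]_2 := (c (val A))`_i.

Lemma corner_in (A : E) i : (i <= arc_len A)%N -> corner A i \in c (val A).
Proof. by move=> h; rewrite mem_nth // size_arc. Qed.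

Lemma arc_pt0 (A : E) i : arc_pt (c (val A)) i 0 = corner A i.
Proof. by rewrite /arc_pt subr0 scale1r scale0r addr0. Qed.

Lemma arc_pt1 (A : E) i : arc_pt (c (val A)) i 1 = corner A i.+1.
Proof. by rewrite /arc_pt subrr scale1r scale0r add0r. Qed.

Lemma arc_inj (A : E) i j t u : (i < arc_len A)%N -> (j < arc_len A)%N ->
  0 <= t <= 1 -> 0 <= u <= 1 ->
  arc_pt (c (val A)) i t = arc_pt (c (val A)) j u -> i%:R + t = j%:R + u.
Proof.
by move=> hi hj; have [_] := drawing_simple drawing (valP A); apply; rewrite size_arc.
Qed.

(* Every corner is the point with some parameter in a segment, so that the
   injectivity of the parametrisation applies to it. *)
Lemma corner_pt (A : E) k : (k <= arc_len A)%N -> exists j u,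
  [/\ (j < arc_len A)%N, 0 <= u <= 1, corner A k = arc_pt (c (val A)) j u &
      j%:R + u = k%:R].
Proof.
case: k => [|k] h.
  by exists 0%N, 0; rewrite arc_pt0 arc_len_gt0 lexx ler01 addr0.
by exists k, 1; rewrite arc_pt1 ler01 lexx natr1.
Qed.

Lemma arc_corner (A : E) i k t : (i < arc_len A)%N -> (k <= arc_len A)%N ->
  0 <= t <= 1 -> arc_pt (c (val A)) i t = corner A k -> i%:R + t = k%:R.
Proof.
move=> hi /corner_pt[j [u [hj hu -> <-]]] ht; exact: arc_inj.
Qed.

Lemma corner_inj (A : E) i j : (i <= arc_len A)%N -> (j <= arc_len A)%N ->
  corner A i = corner A j -> i = j.
Proof.
move=> /corner_pt[i' [t [hi ht -> e]]] hj /(arc_corner hi hj ht).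
by rewrite e => /eqP; rewrite eqr_nat => /eqP.
Qed.

Lemma end_vertices (A : E) : exists x y,
  [/\ val A = [set x; y], corner A 0 = f x & corner A (arc_len A) = f y].
Proof.
have [x [y [e1 e2 e3]]] := drawing_ends drawing (valP A).
by exists x, y; rewrite /corner nth0 e2 /arc_len nth_last e3.
Qed.

Lemma first_vertexP (A : E) : exists x, corner A 0 == f x.
Proof. by have [x [y [_ e _]]] := end_vertices A; exists x; apply/eqP. Qed.

Lemma last_vertexP (A : E) : exists x, corner A (arc_len A) == f x.
Proof. by have [x [y [_ _ e]]] := end_vertices A; exists y; apply/eqP. Qed.

Definition edge_tgt (A : E) (b : bool) : G :=
  if b then xchoose (last_vertexP A) else xchoose (first_vertexP A).

Arguments edge_tgt : simpl never.

Definition edge_src (A : E) (b : bool) : G := edge_tgt A (~~ b).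

Definition tgt_idx (A : E) (b : bool) : nat := if b then arc_len A else 0%N.

Lemma tgt_idx_le A b : (tgt_idx A b <= arc_len A)%N.
Proof. by case: b. Qed.

Lemma edge_tgtE A b : f (edge_tgt A b) = corner A (tgt_idx A b).
Proof. by case: b; apply/esym/eqP; [exact: (xchooseP (last_vertexP A)) | exact: (xchooseP (first_vertexP A))]. Qed.

Lemma edge_srcE A : val A = [set edge_src A true; edge_tgt A true].
Proof.
have [x [y [-> e1 e2]]] := end_vertices A.
have -> : edge_src A true = x.
  by apply: (drawing_inj drawing); rewrite /edge_src edge_tgtE.
have -> // : edge_tgt A true = y.
by apply: (drawing_inj drawing); rewrite edge_tgtE.
Qed.

Lemma edge_endsE A b : val A = [set edge_src A b; edge_tgt A b].
Proof. by case: b; rewrite edge_srcE // setUC. Qed.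

Lemma edge_src_neq_tgt A b : edge_tgt A b != edge_src A b.
Proof.
apply/eqP => /(congr1 f); rewrite /edge_src !edge_tgtE => /corner_inj.
rewrite !tgt_idx_le => /(_ isT isT); have := arc_len_gt0 A.
by case: b => /= + e; rewrite ?e // -e.
Qed.

Lemma edge_vertex (A : E) v : v \in val A -> exists b, edge_tgt A b = v.
Proof.
by rewrite (edge_srcE A) !inE => /orP[] /eqP ->; [exists false | exists true].
Qed.

Definition seg : finType := {A : E & 'I_(arc_len A)}.

Local Notation mkseg i := (Tagged (fun A : E => 'I_(arc_len A)) i : seg).

Definition seg_pt (s : seg) (b : bool) : 'rV[R]_2 := corner (tag s) (tagged s + b).

Lemma seg_pt_in s b : seg_pt s b \in c (val (tag s)).
Proof.
by apply: corner_in; case: b; rewrite ?addn0 ?addn1 // ltnW.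
Qed.

(** On one arc, injectivity gives [i + t = j + u] with [i] and [j] distinct, so [t] is extreme. On
    two arcs the common point is a vertex of both edges, hence an end corner of the first arc. *)
Lemma seg_arc_meet (s s' : seg) t u : s != s' -> 0 <= t <= 1 -> 0 <= u <= 1 ->
  arc_pt (c (val (tag s))) (tagged s) t = arc_pt (c (val (tag s'))) (tagged s') u ->
  t = 0 \/ t = 1.
Proof.
case: s s' => A i [B j] /= ns ht hu e.
have hi := ltn_ord i; have hj := ltn_ord j.
have [eAB|nAB] := eqVneq A B.
  subst B; have nij : (i : nat) != j.
    by apply: contraNneq ns => eij; apply/eqP; congr Tagged; apply: val_inj.
  have := arc_inj hi hj ht hu e.
  case: (ltngtP i j) nij => // lt _ e'; [right|left];
    by move: lt; rewrite -(ler_nat R) -natr1 => lt; lra.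
have on (C : E) (k : 'I_(arc_len C)) v : 0 <= v <= 1 ->
    on_arc (c (val C)) (arc_pt (c (val C)) k v).
  by move=> hv; exists k, v; rewrite size_arc ltnS ltn_ord.
have nAB' : val A != val B by rewrite (inj_eq val_inj).
have := drawing_noncrossing drawing (valP A) (valP B) nAB' (on A i t ht).
rewrite {1}e => /(_ (on B j u hu)) [v]; rewrite inE => /andP[/edge_vertex[b <-] _].
rewrite edge_tgtE => /(arc_corner hi (tgt_idx_le A b) ht).
case: b => /= e'; [right|left].
  have : (i.+1%:R <= (arc_len A)%:R :> R) by rewrite ler_nat.
  by rewrite -natr1 => lt; lra.
by have : (0 <= i%:R :> R) by []; lra.
Qed.

Lemma seg_pt_px_neq s : X (seg_pt s false) != X (seg_pt s true).
Proof.
apply/eqP => /(generic (seg_pt_in s false) (seg_pt_in s true)) /corner_inj.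
by rewrite addn0 addn1 ltn_ord (ltnW (ltn_ord _)) => /(_ isT isT) /n_Sn.
Qed.

(** Tells whether the arc runs rightwards along [s]. The test [b == fw s] converts directions along
    the arc into directions along the axis, and back. *)
Definition fw (s : seg) : bool := X (seg_pt s false) < X (seg_pt s true).
Definition sl (s : seg) : R := X (seg_pt s (~~ fw s)).
Definition sr (s : seg) : R := X (seg_pt s (fw s)).
Definition sslope (s : seg) : R :=
  (Y (seg_pt s true) - Y (seg_pt s false)) / (X (seg_pt s true) - X (seg_pt s false)).
Definition sicpt (s : seg) : R := Y (seg_pt s false) - sslope s * X (seg_pt s false).

Lemma lt_slr s : sl s < sr s.
Proof.
rewrite /sl /sr; have := seg_pt_px_neq s; case: (boolP (fw s)) => //=.
by rewrite /fw -leNgt => le ne; rewrite lt_neqAle le eq_sym ne.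
Qed.

Lemma seg_endE s b : seg_end sl sr s b = X (seg_pt s (b == fw s)).
Proof. by case: b; rewrite /seg_end /sl /sr; case: (fw s). Qed.

Lemma ht_seg s t : ht sicpt sslope s (X (arc_pt (c (val (tag s))) (tagged s) t))
  = Y (arc_pt (c (val (tag s))) (tagged s) t).
Proof.
have ne := seg_pt_px_neq s.
have ne' : X (seg_pt s true) - X (seg_pt s false) != 0 by rewrite subr_eq0 eq_sym.
rewrite /ht /sicpt /sslope.
have -> : X (arc_pt (c (val (tag s))) (tagged s) t)
   = X (seg_pt s false) + t * (X (seg_pt s true) - X (seg_pt s false)).
  by rewrite /arc_pt /seg_pt /corner addn0 addn1 /px !mxE; ring.
have -> : Y (arc_pt (c (val (tag s))) (tagged s) t)
   = Y (seg_pt s false) + t * (Y (seg_pt s true) - Y (seg_pt s false)).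
  by rewrite /arc_pt /seg_pt /corner addn0 addn1 /py !mxE; ring.
by field.
Qed.

Lemma seg_pt_arc s b : seg_pt s b = arc_pt (c (val (tag s))) (tagged s) b%:R.
Proof. by case: b; rewrite ?arc_pt0 ?arc_pt1 /seg_pt ?addn0 ?addn1. Qed.

Lemma ht_seg_end s b :
  ht sicpt sslope s (seg_end sl sr s b) = Y (seg_pt s (b == fw s)).
Proof. by rewrite seg_endE seg_pt_arc ht_seg. Qed.

Lemma seg_end_pt s s' b b' : seg_end sl sr s b = seg_end sl sr s' b' ->
  seg_pt s (b == fw s) = seg_pt s' (b' == fw s').
Proof.
by rewrite !seg_endE; apply: (@generic (tag s) (tag s')); apply: seg_pt_in.
Qed.

Lemma seg_ht_end s s' b b' : seg_end sl sr s b = seg_end sl sr s' b' ->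
  ht sicpt sslope s (seg_end sl sr s b) = ht sicpt sslope s' (seg_end sl sr s' b').
Proof. by move=> /seg_end_pt e; rewrite !ht_seg_end e. Qed.

Lemma seg_param s x : sl s <= x <= sr s -> exists t, 0 <= t <= 1 /\
  X (arc_pt (c (val (tag s))) (tagged s) t) = x.
Proof.
move=> hx; have lt := lt_slr s.
have hX t : X (arc_pt (c (val (tag s))) (tagged s) t)
   = X (seg_pt s false) + t * (X (seg_pt s true) - X (seg_pt s false)).
  by rewrite /arc_pt /seg_pt /corner addn0 addn1 /px !mxE; ring.
have d0 : 0 < sr s - sl s by lra.
pose t := (x - sl s) / (sr s - sl s).
have t0 : 0 <= t by rewrite divr_ge0; lra.
have t1 : t <= 1 by rewrite ler_pdivrMr // mul1r; lra.
have et : t * (sr s - sl s) = x - sl s by rewrite mulfVK // gt_eqF.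
exists (if fw s then t else 1 - t).
rewrite hX; move: et; rewrite /sl /sr; case: (fw s) => /= et; split; lra.
Qed.

Lemma seg_noncrossing s s' x : s != s' -> sl s <= x <= sr s -> sl s' <= x <= sr s' ->
  ht sicpt sslope s x = ht sicpt sslope s' x -> (x == sl s) || (x == sr s).
Proof.
move=> ns /seg_param[t [ht e]] /seg_param[u [hu e']].
rewrite -{1}e -{1}e' !ht_seg => eY.
have ept := pxy_inj (etrans e (esym e')) eY.
rewrite -e; have [t0|t1] := seg_arc_meet ns ht hu ept.
  have -> : arc_pt (c (val (tag s))) (tagged s) t = seg_pt s false by rewrite seg_pt_arc t0.
  by rewrite /sl /sr; case: (fw s); rewrite eqxx ?orbT.
have -> : arc_pt (c (val (tag s))) (tagged s) t = seg_pt s true by rewrite seg_pt_arc t1.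
by rewrite /sl /sr; case: (fw s); rewrite eqxx ?orbT.
Qed.

Definition segs_of (z : {set E}) : {set seg} := [set s | tag s \in z].

Lemma xor_telescope (u : nat -> bool) n :
  \big[addb/false]_(i < n) (u i (+) u i.+1) = u 0%N (+) u n.
Proof.
elim: n => [|n IH]; first by rewrite big_ord0 addbb.
by rewrite big_ord_recr /= IH addbA addbK.
Qed.

(** Along each arc the inner corners cancel by telescoping, leaving the two end vertices; after
    exchanging the sums, each vertex occurs an even number of times. *)
Lemma closed_segs_of z : z \in even_sets edge_src edge_tgt -> closed_chain sl sr (segs_of z).
Proof.
rewrite inE => /forallP zev U.
transitivity (\big[addb/false]_(A in z) \big[addb/false]_(i < arc_len A)
    (U (X (corner A i)) (+) U (X (corner A i.+1)))).
  rewrite sig_big_dep; apply: eq_big => [s|s _]; first by rewrite inE andbT.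
  by rewrite /sl /sr /seg_pt; case: (fw s); rewrite addn0 addn1 // addbC.
transitivity (\big[addb/false]_(A in z) \big[addb/false]_(v : G)
    (((edge_src A true == v) (+) (edge_tgt A true == v)) && U (X (f v)))).
  apply: eq_bigr => A _; rewrite (xor_telescope (fun i => U (X (corner A i)))).
  rewrite (eq_bigr (fun v => (edge_src A true == v) && U (X (f v))
     (+) (edge_tgt A true == v) && U (X (f v)))); last by move=> v _; rewrite andb_addl.
  rewrite big_split /=; congr addb.
    rewrite (bigD1 (edge_src A true)) //= eqxx /= big1 ?addbF; last first.
      by move=> v; rewrite eq_sym => /negPf ->.
    by rewrite /edge_src edge_tgtE.
  rewrite (bigD1 (edge_tgt A true)) //= eqxx /= big1 ?addbF; last first.
    by move=> v; rewrite eq_sym => /negPf ->.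
  by rewrite edge_tgtE.
rewrite exchange_big /=; apply: big1 => v _.
have := zev v; rewrite /odd_degree; case: (U (X (f v))).
  by move/negPf => e; rewrite -[RHS]e; apply: eq_bigr => A _; rewrite andbT.
by move=> _; rewrite big1 // => A _; rewrite andbF.
Qed.

Definition seg_parity (z : {set E}) (s : seg) (b : bool) : bool :=
  left_parity sl sr sicpt sslope (segs_of z) s (b == fw s).

Lemma seg_parity_rev z s b :
  seg_parity z s b (+) seg_parity z s (~~ b) = (tag s \in z).
Proof.
rewrite /seg_parity; have -> : (~~ b == fw s) = ~~ (b == fw s) by case: b; case: (fw s).
by rewrite left_parity_rev inE.
Qed.

Lemma next_seg s b : (exists s1 b1, s1 != s /\ seg_pt s1 b1 = seg_pt s b) ->
  exists s' b', [/\ s' != s, seg_pt s' (~~ b') = seg_pt s b &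
    forall z, z \in even_sets edge_src edge_tgt -> seg_parity z s b = seg_parity z s' b'].
Proof.
have fwK s0 b0 : ((b0 == fw s0) == fw s0) = b0 by case: b0; case: (fw s0).
move=> [s1 [b1 [n1 e1]]].
have [|s' [b' [n' e' h']]] :=
    next_dart lt_slr seg_noncrossing seg_ht_end (s := s) (b := b == fw s).
  by exists s1, (b1 == fw s1); rewrite !seg_endE !fwK e1.
exists s', (b' == fw s'); split => //.
  move/seg_end_pt: e'; rewrite fwK => <-; congr seg_pt.
  by case: (b'); case: (fw s').
by move=> z /closed_segs_of /h' hz; rewrite /seg_parity hz fwK.
Qed.

(* An inner corner lies on the two segments of its own arc that meet there only. *)
Lemma seg_parity_step (A : E) (i j : 'I_(arc_len A)) z : j = i.+1 :> nat ->
  z \in even_sets edge_src edge_tgt ->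
  seg_parity z (mkseg i) true = seg_parity z (mkseg j) true.
Proof.
move=> ij zev; pose s : seg := mkseg i.
have [|s' [b' [n' e' h']]] := @next_seg s true.
  exists (mkseg j), false; split.
    by apply/eqP => /eqP; rewrite eq_Tagged /= => /eqP ji; move: ij; rewrite ji => /n_Sn.
  by rewrite /seg_pt /= addn0 addn1 ij.
have hj := ltn_ord j.
suff [es eb] : s' = mkseg j /\ b' = true by rewrite h' // es eb.
case: s' n' e' {h'} => B k /= n' e'.
have [eB|nB] := eqVneq B A.
  subst B; have := corner_inj _ _ e'; rewrite /= addn1 ltn_ord => ek.
  have {}ek : (k + ~~ b' = i.+1)%N.
    by apply: ek => //; case: (b'); rewrite ?addn0 ?addn1 //= ltnW.
  case: b' ek {e'} => /=; rewrite ?addn0 ?addn1 => ek.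
    by split => //; congr Tagged; apply: val_inj; rewrite /= ek -ij.
  by case/negP: n'; apply/eqP; congr Tagged; apply: val_inj; case: ek.
have on (C : E) (m : 'I_(arc_len C)) (b : bool) : on_arc (c (val C)) (seg_pt (mkseg m) b).
  by exists m, b%:R; rewrite seg_pt_arc size_arc ltnS ltn_ord; split=> //; case: b; rewrite ?lexx ler01.
have nB' : val B != val A by rewrite (inj_eq val_inj).
have := drawing_noncrossing drawing (valP B) (valP A) nB' (on B k (~~ b')).
rewrite e' => /(_ (on A i true)) [v]; rewrite inE => /andP[_ /edge_vertex[b <-]].
rewrite edge_tgtE => /corner_inj; rewrite /= addn1 ltn_ord tgt_idx_le => /(_ isT isT).
by case: b => //= ei; move: hj; rewrite ij ei ltnn.
Qed.

(** Forward parities propagate from the first segment. Backward ones differ from them by the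
    membership of [A] in [z], which is common to all segments of the arc. *)
Lemma seg_parity_const (A : E) (i j : 'I_(arc_len A)) b z :
  z \in even_sets edge_src edge_tgt ->
  seg_parity z (mkseg i) b = seg_parity z (mkseg j) b.
Proof.
move=> zev.
have first (m : nat) (hm : (m < arc_len A)%N) :
    seg_parity z (mkseg (Ordinal hm)) true =
    seg_parity z (mkseg (Ordinal (arc_len_gt0 A))) true.
  elim: m hm => [|m IH] hm; first by congr seg_parity; congr Tagged; apply: val_inj.
  by rewrite -(IH (ltnW hm)); apply/esym/seg_parity_step.
have main (m : 'I_(arc_len A)) : seg_parity z (mkseg m) true =
    seg_parity z (mkseg (Ordinal (arc_len_gt0 A))) true.
  by case: m => m hm; apply: first.
case: b; first by rewrite !main.
have := seg_parity_rev z (mkseg i) true; rewrite -(seg_parity_rev z (mkseg j) true) /=.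
by rewrite !main => /addbI.
Qed.

Definition first_idx (A : E) : 'I_(arc_len A) := Ordinal (arc_len_gt0 A).

Lemma last_idx_subproof (A : E) : ((arc_len A).-1 < arc_len A)%N.
Proof. by rewrite prednK // arc_len_gt0. Qed.

Definition last_idx (A : E) : 'I_(arc_len A) := Ordinal (last_idx_subproof A).

Definition tgt_seg (A : E) (b : bool) : seg :=
  mkseg (if b then last_idx A else first_idx A).

Lemma tgt_seg_pt A b : seg_pt (tgt_seg A b) b = f (edge_tgt A b).
Proof.
rewrite edge_tgtE /seg_pt /=; case: b => /=; last by [].
by rewrite addn1 prednK // arc_len_gt0.
Qed.

(** An arc meets only the vertices of its own edge, and these only at its extreme corners; so [s] is
    an extreme segment, traversed outwards. *)
Lemma seg_pt_vertex s b v : seg_pt s b = f v ->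
  exists2 b', s = tgt_seg (tag s) b' /\ b = b' & edge_tgt (tag s) b' = v.
Proof.
move=> e.
have on : on_arc (c (val (tag s))) (f v).
  exists (tagged s), b%:R; rewrite -e seg_pt_arc size_arc ltnS ltn_ord.
  by split=> //; case: (b); rewrite ?lexx ler01.
have /edge_vertex[b' ev] := drawing_vertex drawing (valP (tag s)) on.
exists b' => //; move: e; rewrite -ev edge_tgtE => /corner_inj.
rewrite tgt_idx_le => /(_ _ isT) ei.
have {}ei : (tagged s + b = tgt_idx (tag s) b')%N.
  by apply: ei; case: (b); rewrite ?addn0 ?addn1 ?ltn_ord // ltnW.
case: s {on ev} ei => A i /=; have hi := ltn_ord i; case: b' => /= ei; split.
- congr Tagged; apply: val_inj => /=; case: b ei; rewrite ?addn0 ?addn1 => ei; last by move: hi; rewrite ei ltnn.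
  exact: (congr1 predn ei).
- by case: b ei => //; rewrite addn0 => ei; move: hi; rewrite ei ltnn.
- by congr Tagged; apply: val_inj => /=; case: b ei; rewrite ?addn0 ?addn1.
- by case: b ei => //; rewrite addn1.
Qed.

Definition edge_parity (z : {set E}) (A : E) (b : bool) : bool :=
  seg_parity z (tgt_seg A b) b.

Lemma edge_parity_rev z A b : z \in even_sets edge_src edge_tgt ->
  edge_parity z A b (+) edge_parity z A (~~ b) = (A \in z).
Proof.
move=> zev; rewrite -(seg_parity_rev z (tgt_seg A b) b); congr addb.
exact: seg_parity_const.
Qed.

Hypothesis degree_ge2 : min_degree_ge G 2.

(** Of two distinct neighbours of [v], at most one lies in [A]. *)
Lemma other_edge (A : E) v : v \in val A -> exists2 B : E, B != A & v \in val B.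
Proof.
move=> vA.
have [y yA vy] : exists2 y, y \notin val A & adj v y.
  have /card_gt1P[y1 [y2 [h1 h2 n12]]] := degree_ge2 v.
  rewrite !inE in h1 h2.
  have [i1|] := boolP (y1 \in val A); last by exists y1.
  have [i2|] := boolP (y2 \in val A); last by exists y2.
  have nv y : adj v y -> y != v by apply: contraTneq => ->; rewrite adj_irrefl.
  move: vA i1 i2 (nv _ h1) (nv _ h2) n12; rewrite (edge_srcE A) !inE.
  by do 3![case/orP => /eqP ->]; rewrite ?eqxx.
have hB : [set v; y] \in edges G.
  by rewrite inE; apply/existsP; exists v; apply/existsP; exists y; rewrite vy eqxx.
exists (Sub [set v; y] hB); last by rewrite SubK !inE eqxx.
by apply: contraNneq yA => <-; rewrite SubK !inE eqxx orbT.
Qed.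

(** A second edge at the target supplies the second segment that [next_seg] requires; the resulting
    dart is then moved along its arc to the far end. *)
Lemma edge_parity_next A b : exists A' b', [/\ edge_src A' b' = edge_tgt A b,
  edge_tgt A' b' != edge_src A b &
  forall z, z \in even_sets edge_src edge_tgt -> edge_parity z A b = edge_parity z A' b'].
Proof.
have [|B nBA] := @other_edge A (edge_tgt A b); first by rewrite (edge_endsE A b) !inE eqxx orbT.
move=> /edge_vertex [b1 e1].
have [|s' [b' [n' e' h']]] := @next_seg (tgt_seg A b) b.
  exists (tgt_seg B b1), b1; split; last by rewrite !tgt_seg_pt e1.
  by apply: contraNneq nBA => /(congr1 tag) /= ->.
rewrite tgt_seg_pt in e'.
have [b2 [es eb] ev] := seg_pt_vertex e'.
(* A segment of [A] other than [tgt_seg A b] could only touch a vertex at the opposite end of the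
   arc, which is a different vertex. *)
have nA : tag s' != A.
  apply: contraNneq n' => eA; move: ev es; rewrite eA => ev ->.
  have [<-//|nb] := eqVneq b2 b.
  have eb2 : b2 = ~~ b by case: (b2) nb; case: (b).
  by have := edge_src_neq_tgt A b; rewrite /edge_src -eb2 ev eqxx.
exists (tag s'), b'; split; first by rewrite /edge_src eb.
  (* Simplicity of [G]: returning to the source would give two edges with the same ends. *)
  apply: contra_neq nA => et; apply: val_inj.
  by rewrite (edge_endsE _ b') (edge_endsE A b) et /edge_src eb ev setUC.
move=> z zev; rewrite /edge_parity h' // es; exact: seg_parity_const.
Qed.

Lemma drawing_card_edges : (#|{: E}| <= 3 * #|G|)%N.
Proof.
exact: (card_edges_le (L := edge_parity) (fun z A b => @edge_parity_rev z A b)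
  edge_src_neq_tgt edge_parity_next).
Qed.

End Drawing.

Lemma planar_card_edges (R : realType) (G : sgraph) :
  planar R G -> min_degree_ge G 2 -> (#|edges G| <= 3 * #|G|)%N.
Proof.
move=> [f [c dr]] dG.
have [lam gen] := generic_shear (flatten [seq c (val A) | A : line_vertex G]).
have := @drawing_card_edges R G f c dr lam _ dG.
rewrite card_sub; apply => A B p q hp hq; apply: gen; apply/flatten_mapP.
  by exists A; rewrite ?mem_enum.
by exists B; rewrite ?mem_enum.
Qed.

(** * Degrees in the line graph *)

Lemma k_independent_sub (H : sgraph) k (S S' : {set H}) :
  S' \subset S -> k_independent k S -> k_independent k S'.
Proof.
move=> sub /forall_inP h; apply/forall_inP => x /(subsetP sub) xS.
apply: leq_trans (h x xS); apply: subset_leq_card; apply/subsetP => y.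
by rewrite !inE => /andP[/(subsetP sub) -> ->].
Qed.

(** Each class of an optimal colouring meets [D H i] in a regular [k]-independent set. *)
Lemma card_D_le (H : sgraph) k i : (#|D H i| <= alpha_reg H k * chi H k)%N.
Proof.
have [->|[x xD]] := set_0Vmem (D H i); first by rewrite cards0.
have iH : (i < #|H|.+1)%N.
  by move: xD; rewrite inE => /eqP <-; rewrite ltnS max_card.
rewrite /chi; case: ex_minnP => n /existsP[col /forallP hcol] _.
rewrite -sum1_card (partition_big col predT) //= mulnC -[X in (_ <= X * _)%N]card_ord -sum_nat_const.
apply: leq_sum => a _; rewrite sum1dep_card.
apply: (@leq_bigmax_cond _ _ (fun S : {set H} => #|S|)); apply/andP; split.
  by apply: k_independent_sub (hcol a); apply/subsetP => y; rewrite !inE => /andP[].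
apply/existsP; exists (Ordinal iH); apply/subsetP => y.
by rewrite !inE => /andP[].
Qed.

Section LineDegrees.
Variable G : sgraph.
Local Notation E := (line_vertex G).

Lemma edge_pair (A : E) : exists x y, adj x y /\ val A = [set x; y].
Proof.
have := valP A; rewrite inE => /existsP[x /existsP[y /andP[xy /eqP e]]].
by exists x, y.
Qed.

Lemma adj_neq (x y : G) : adj x y -> x != y.
Proof. by apply: contraTneq => ->; rewrite adj_irrefl. Qed.

Lemma card_incident (v : G) : #|[set A : E | v \in val A]| = degree v.
Proof.
rewrite -(card_imset _ val_inj) /degree.
have inj : {in [set y | adj v y] &, injective (fun y => [set v; y])}.
  move=> y y'; rewrite !inE => /adj_neq vy /adj_neq vy' /setP/(_ y).
  by rewrite !inE eqxx orbT eq_sym (negPf vy) /= => /esym/eqP.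
rewrite -(card_in_imset inj); apply: eq_card => B; apply/imsetP/imsetP.
  case=> A; rewrite inE => vA ->; have [x [y [xy e]]] := edge_pair A.
  move: vA; rewrite e !inE => /orP[] /eqP ->.
    by exists y; rewrite ?inE.
  by exists x; rewrite ?inE ?(adj_sym y) // setUC.
case=> y; rewrite inE => vy ->.
have hB : [set v; y] \in edges G.
  by rewrite inE; apply/existsP; exists v; apply/existsP; exists y; rewrite vy eqxx.
by exists (Sub [set v; y] hB); rewrite // !inE eqxx.
Qed.

(** Inclusion-exclusion: the edges at [x] and those at [y] share only [A], and their union is [A]
    with its neighbours in the line graph. *)
Lemma line_degree (A : E) x y : adj x y -> val A = [set x; y] ->
  (@degree (line_graph G) A + 2 = degree x + degree y)%N.
Proof.
move=> /adj_neq xy eA; rewrite -!card_incident -cardsUI.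
have -> : [set B : E | x \in val B] :&: [set B : E | y \in val B] = [set A].
  apply/setP => B; rewrite !inE; apply/andP/eqP => [[xB yB]|->]; last first.
    by rewrite eA !inE !eqxx orbT.
  apply: val_inj; have [u [v [uv e]]] := edge_pair B.
  move: xB yB xy; rewrite eA e !inE.
  by do 2![case/orP => /eqP ->]; rewrite ?eqxx // setUC.
have -> : [set B : E | x \in val B] :|: [set B : E | y \in val B] =
    A |: [set B : E | @line_adj G A B].
  apply/setP => B; rewrite !inE /= (eq_sym B A).
  have [<-|nAB] /= := eqVneq A B; first by rewrite eA !inE eqxx.
  rewrite /line_adj /= nAB -[sval A]/(val A) eA; apply/orP/set0Pn => [[xB|yB]|[w]].
  - by exists x; rewrite !inE eqxx.
  - by exists y; rewrite !inE eqxx orbT.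
  - by rewrite !inE => /andP[/orP[] /eqP -> ->]; [left|right].
by rewrite cardsU1 cards1 inE line_adj_irrefl addnAC addnC.
Qed.

Lemma sum_inv_degree (R : numFieldType) : min_degree_ge G 1 ->
  \sum_(A : E) \sum_(v in val A) (degree v)%:R^-1 = #|G|%:R :> R.
Proof.
move=> dG; rewrite (exchange_big_dep predT) //=.
rewrite -sum1_card natr_sum; apply: eq_bigr => v _.
rewrite sumr_const.
have -> : #|[pred A : E | v \in val A]| = degree v.
  by rewrite -card_incident; apply: eq_card => A; rewrite !inE.
by rewrite -[LHS]mulr_natr mulVf // pnatr_eq0 -lt0n; apply: dG.
Qed.

End LineDegrees.

(** * Distribution of the edges over the degree sums *)

Section WeightClasses.
Variables (R : realType) (G : sgraph) (d : nat).
Hypothesis d_gt1 : (1 < d)%N.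
Hypothesis dG : min_degree_ge G d.
Local Notation E := (line_vertex G).

(* The degree sum [a + b] of an edge determines its degree in the line graph;
   for [d <= a, b], [1/a + 1/b] is largest, given the sum, at [a = d]. *)
Definition excess (A : E) : nat := (@degree (line_graph G) A + 2 - d)%N.

Lemma inv_add_le (a b : nat) : (d <= a)%N -> (d <= b)%N ->
  a%:R^-1 + b%:R^-1 <= d%:R^-1 + (a + b - d)%:R^-1 :> R.
Proof.
move=> da db; have d0 : 0 < d%:R :> R by rewrite ltr0n; lia.
have da' : d%:R <= a%:R :> R by rewrite ler_nat.
have db' : d%:R <= b%:R :> R by rewrite ler_nat.
rewrite natrB ?natrD; last by lia.
set x := a%:R in da' *; set y := b%:R in db' *; set e := d%:R in d0 da' db' *.
have x0 : 0 < x by lra.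
have y0 : 0 < y by lra.
have w0 : 0 < x + y - e by lra.
rewrite -subr_ge0.
(* The two hypotheses enter as the nonnegative factors [x - e] and [y - e]. *)
have -> : e^-1 + (x + y - e)^-1 - (x^-1 + y^-1) =
    (x + y) * ((x - e) * (y - e)) / (x * y * e * (x + y - e)).
  by field; rewrite ?gt_eqF.
apply: divr_ge0; last by rewrite !mulr_ge0 // ltW.
by apply: mulr_ge0; [|apply: mulr_ge0]; lra.
Qed.

Lemma excess_ge (A : E) : (d <= excess A)%N.
Proof.
have [x [y [xy e]]] := edge_pair A; rewrite /excess (line_degree xy e).
by have := dG x; have := dG y; lia.
Qed.

Lemma sum_excess : (#|G|%:R : R) <= \sum_(A : E) (d%:R^-1 + (excess A)%:R^-1).
Proof.
rewrite -sum_inv_degree; last by move=> v; apply: leq_trans (dG v); lia.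
apply: ler_sum => A _; have [x [y [xy e]]] := edge_pair A.
rewrite /excess (line_degree xy e) e big_setU1 ?big_set1 ?inE ?adj_neq //=.
exact: inv_add_le.
Qed.

Lemma card_excess_le k j : (d <= j)%N ->
  (#|[set A : E | excess A == j]| <= alpha_reg (line_graph G) k * chi (line_graph G) k)%N.
Proof.
(* Excess [j] means line-graph degree [j + d - 2]; no subtraction truncates, as [2 <= d <= j]. *)
move=> dj; apply: leq_trans (card_D_le (line_graph G) k (j + d - 2)).
apply: subset_leq_card; apply/subsetP => A; rewrite !inE => /eqP e.
by apply/eqP; have := excess_ge A; move: e; rewrite /excess; lia.
Qed.

(** Every edge is charged [1/J]. Only edges of excess [j < J] need the surplus [1/j - 1/J], and each
    such class has at most [M] edges. This bounds the number of vertices from above, to be compared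
    with [m <= 3 n]. *)
Lemma weight_class_bound k (J : nat) : (d <= J)%N -> planar R G ->
  #|edges G|%:R * (3^-1 - d%:R^-1 - J%:R^-1) <=
  (alpha_reg (line_graph G) k * chi (line_graph G) k)%:R *
    \sum_(d <= j < J) (j%:R^-1 - J%:R^-1) :> R.
Proof.
move=> dJ plG; set M := (alpha_reg _ k * _)%N; set m := #|edges G|.
have J0 : 0 < J%:R :> R by rewrite ltr0n; lia.
have mn : m%:R <= 3 * #|G|%:R :> R.
  rewrite -natrM ler_nat; apply: planar_card_edges plG _ => v.
  exact: leq_trans (dG v).
have cE : #|{: E}| = m by rewrite card_sub; apply: eq_card.
have hA (A : E) : (excess A)%:R^-1 <= J%:R^-1 +
    \sum_(d <= j < J) (excess A == j)%:R * (j%:R^-1 - J%:R^-1) :> R.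
  have nneg j : (d <= j < J)%N -> 0 <= j%:R^-1 - J%:R^-1 :> R.
    move=> /andP[dj jJ]; rewrite subr_ge0 lef_pV2 ?posrE ?ltr0n ?ler_nat; lia.
  have [JA|AJ] := leqP J (excess A).
    rewrite ler_wpDr //; last by rewrite lef_pV2 ?posrE ?ltr0n ?ler_nat; lia.
    by rewrite big_nat; apply: sumr_ge0 => j /nneg h; rewrite mulr_ge0.
  rewrite (bigD1_seq (excess A)) ?iota_uniq ?mem_index_iota ?excess_ge //=.
  rewrite eqxx mul1r big1 ?addr0; first by rewrite addrC subrK.
  by move=> j; rewrite eq_sym => /negPf ->; rewrite mul0r.
have le1 : \sum_(A : E) (excess A)%:R^-1 <= m%:R * J%:R^-1 +
    M%:R * \sum_(d <= j < J) (j%:R^-1 - J%:R^-1) :> R.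
  apply: le_trans (ler_sum _ (fun A _ => hA A)) _.
  rewrite big_split /= sumr_const cE mulr_natl lerD2l exchange_big /= mulr_sumr.
  rewrite big_nat [X in _ <= X]big_nat; apply: ler_sum => j /andP[dj jJ].
  rewrite -mulr_suml ler_wpM2r //.
    by rewrite subr_ge0 lef_pV2 ?posrE ?ltr0n ?ler_nat; lia.
  rewrite -natr_sum ler_nat; apply: leq_trans (card_excess_le k dj).
  by rewrite -sum1dep_card [X in (_ <= X)%N]big_mkcond /=; apply: leq_sum => A _; case: eqP.
have := sum_excess; rewrite big_split /= sumr_const cE -mulr_natl => le2.
lra.
Qed.

End WeightClasses.

Theorem theorem4p4 (R : realType) (k m : nat) (G : sgraph)
    (hG : triangulation R G) (hm : m = #|edges G|) :
  (min_degree_ge G 4 ->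
     (m%:R / (68 * (chi (line_graph G) k)%:R) : R)
       <= (alpha_reg (line_graph G) k)%:R) /\
  (min_degree_ge G 5 ->
     (m%:R / (51 * (chi (line_graph G) k)%:R) : R)
       <= (alpha_reg (line_graph G) k)%:R).
Proof.
have plG := hG.1.
have reduce (C : R) : 0 < C -> m%:R <= C * (alpha_reg (line_graph G) k * chi (line_graph G) k)%:R ->
    m%:R / (C * (chi (line_graph G) k)%:R) <= (alpha_reg (line_graph G) k)%:R.
  (* If the line graph has no vertices then [chi] is 0, and the quotient is 0 by the convention on
     inverses. *)
  move=> C0 h; have [->|chi0] := posnP (chi (line_graph G) k).
    by rewrite mulr0 invr0 mulr0.
  rewrite ler_pdivrMr ?mulr_gt0 ?ltr0n //; apply: le_trans h _.
  by rewrite natrM mulrCA.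
split=> dG; apply: reduce => //.
  (* The threshold 18 leaves [1/3 - 1/4 - 1/18 = 1/36]; 36 times the sum of the surpluses is below
     30. *)
  have := weight_class_bound (isT : (1 < 4)%N) dG k (isT : (4 <= 18)%N) plG.
  rewrite -hm unlock /=; set M := (_ * _)%:R; have : 0 <= M by [].
  lra.
(* Here [1/3 - 1/5 - 1/10 = 1/30], and 30 times the sum is below 8. *)
have := weight_class_bound (isT : (1 < 5)%N) dG k (isT : (5 <= 10)%N) plG.
rewrite -hm unlock /=; set M := (_ * _)%:R; have : 0 <= M by [].
lra.
Qed.
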